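(* Let $d$ denote the subRiemannian distance from the origin in $\mathbb{E}=\mathbb{R}^4$ (the Engel group) defined by the vector fields $X_1=\partial_1$ and $X_2=\partial_2+x_1\partial_3+\frac{x_1^2}{2}\partial_4$. Then, for all $x_2\in\mathbb{R}$: (i) there is $C>0$ such that, if $|x_4|$ is sufficiently small, $$d(0,x_2,0,x_4)-d(0,x_2,0,0)\ge C|x_4|;$$ (ii) the following horizontal estimate holds: $$\limsup_{(y_1,y_2)\to 0}\frac{d\bigl(e^{y_1X_1+y_2X_2}(0,x_2,0,0)\bigr)-d\bigl((0,x_2,0,0)\bigr)}{y_1^2+y_2^2}=+\infty.$$
   Context: The Engel group is $\mathbb{R}^4$ with the group law $x\cdot\xi=\bigl(x_1+\xi_1,\ x_2+\xi_2,\ x_3+\xi_3+x_1\xi_2,\ x_4+\xi_4+\frac{x_1^2}{2}\xi_2+x_1\xi_3\bigr)$, for which $X_1,X_2$ are left-invariant. A horizontal path is a path $\gamma\in W^{1,2}((0,1),\mathbb{R}^4)$ for which there is $u=(u_1,u_2)\in L^2((0,1),\mathbb{R}^2)$ with $\dot\gamma(s)=u_1(s)X_1(\gamma(s))+u_2(s)X_2(\gamma(s))$ for a.e. $s$; its length is $\int_0^1|u(s)|\,ds$. The subRiemannian (control) distance between two points is the infimum of lengths of horizontal paths joining them, and $d(x)$ denotes the distance of $x$ from the origin. For a vector field $Z$, $e^{Z}(x)$ is the value at time $1$ of the integral curve of $Z$ starting at $x$. *)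

(* Defs.v *)
From HB Require Import structures.
From mathcomp Require Import all_boot all_order all_algebra.
From mathcomp Require Import all_classical all_reals all_analysis.

Set Implicit Arguments.
Unset Strict Implicit.
Unset Printing Implicit Defensive.

Import Order.TTheory GRing.Theory Num.Theory.
Import numFieldNormedType.Exports.

Local Open Scope classical_set_scope.
Local Open Scope ring_scope.

Section Sobolev.
Context {R : realType}.
Implicit Types f g phi : R -> R.

Local Notation mu := (@lebesgue_measure R).

Definition L2_01 f : Prop :=
  measurable_fun `](0 : R), 1[ f /\
  (\int[mu]_(s in `]0%R, 1%R[) ((f s) ^+ 2)%:E < +oo)%E.

Definition tsupport phi : set R := closure [set s | phi s != 0].

(* C^1_c((0,1)), the test functions in Brezis' definition of W^{1,p}(0,1);
   C^oo_c((0,1)) gives the same weak derivatives. *)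
Definition test_function phi : Prop :=
  [/\ forall s, derivable phi s 1,
      continuous (derive1 phi),
      compact (tsupport phi) &
      tsupport phi `<=` `]0, 1[].

Definition weak_derivative f g : Prop :=
  forall phi, test_function phi ->
    \int[mu]_(s in `]0, 1[) (f s * derive1 phi s) =
    - \int[mu]_(s in `]0, 1[) (g s * phi s).

(* [gamma] is in W^{1,2}((0,1), R^n), with weak derivative [dgamma]. A class in
   W^{1,2} is given by its continuous representative on [0,1], which is the one
   used to evaluate it at the end points. *)
Definition sobolev12 n (gamma dgamma : R -> 'rV[R]_n.+1) : Prop :=
  {within `[0, 1], continuous gamma} /\
  forall i, [/\ L2_01 (fun s => gamma s ord0 i),
                L2_01 (fun s => dgamma s ord0 i) &
                weak_derivative (fun s => gamma s ord0 i)
                                (fun s => dgamma s ord0 i)].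

End Sobolev.

Section VectorFields.
Context {R : realType} {n : nat}.
Implicit Types (Z : 'rV[R]_n.+1 -> 'rV[R]_n.+1) (x y : 'rV[R]_n.+1).

Definition integral_curve_01 Z (c : R -> 'rV[R]_n.+1) : Prop :=
  forall t : R, 0 <= t <= 1 -> is_derive t 1 c (Z (c t)).

(* e^Z(x); the value is [x] if no integral curve starting at [x] is defined up
   to time 1. *)
Definition exp_field Z x : 'rV[R]_n.+1 :=
  xget x [set y | exists c, [/\ integral_curve_01 Z c, c 0 = x & c 1 = y]].

End VectorFields.

Section Engel.
Context {R : realType}.

Local Notation mu := (@lebesgue_measure R).

Definition vec4 (a b c d : R) : 'rV[R]_4 := \row_(i < 4) [:: a; b; c; d]`_i.

Definition X1 (x : 'rV[R]_4) : 'rV[R]_4 := vec4 1 0 0 0.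

Definition X2 (x : 'rV[R]_4) : 'rV[R]_4 :=
  let x1 := x ord0 ord0 in vec4 0 1 x1 (x1 ^+ 2 / 2).

Definition horizontal_path (gamma : R -> 'rV[R]_4) (u1 u2 : R -> R) : Prop :=
  [/\ L2_01 u1, L2_01 u2 &
      exists2 dgamma, sobolev12 gamma dgamma &
        {ae mu, forall s, s \in `]0, 1[ ->
           dgamma s = u1 s *: X1 (gamma s) + u2 s *: X2 (gamma s)}].

Definition horizontal_length (u1 u2 : R -> R) : \bar R :=
  (\int[mu]_(s in `]0%R, 1%R[) (Num.sqrt (u1 s ^+ 2 + u2 s ^+ 2))%:E)%E.

Definition cc_dist (x y : 'rV[R]_4) : \bar R :=
  ereal_inf [set l | exists gamma u1 u2,
    [/\ horizontal_path gamma u1 u2, gamma 0 = x, gamma 1 = y &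
        l = horizontal_length u1 u2]].

Definition dist0 (x : 'rV[R]_4) : \bar R := cc_dist 0 x.

End Engel.

(* Main.v *)
Require Import Defs.
From HB Require Import structures.
From mathcomp Require Import all_boot all_order all_algebra.
From mathcomp Require Import all_classical all_reals all_analysis.
From mathcomp Require Import measurable_realfun ring lra.

Set Implicit Arguments.
Unset Strict Implicit.
Unset Printing Implicit Defensive.

Import Order.TTheory GRing.Theory Num.Theory.
Import numFieldNormedType.Exports.

Local Open Scope classical_set_scope.
Local Open Scope ring_scope.

(** A horizontal path issued from the origin is determined by its projection
(x1, x2) to the plane: the length L of the path is the Euclidean length of the
projection, and the fourth coordinate of its end point is the integral of
(x1^2 / 2) u2. Both parts bound L from below by calibrations: |u| is at
least a u1 + b u2 as soon as a^2 + b^2 <= 1, where a and b may depend on the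
time and on x1, so L is at least the integral of a u1 + b u2.

The first calibration has constant b, and an a that changes sign at a time t.
It says that a planar path from the origin to (y1, y2) stays in an ellipse:
(2 x1(t) - y1)^2 + y2^2 <= L^2 ([lift_height]).

Part (i). The end point is (0, x2, 0, x4), so 4 x1^2 <= L^2 - x2^2 all along
the path, and 8 |x4| <= (L^2 - x2^2) L ([lift_closed_estimate]). As long as
L <= |x2| + 1, the right-hand side is at most a constant times L - |x2|; when
L > |x2| + 1 there is nothing to prove for small x4. Finally, the straight
segment shows that d(0, x2, 0, 0) <= |x2| ([dist0_x2_axis_le]).

Part (ii). It suffices to let y tend to 0 along y2 = 0 and y1 > 0, where the
field y1 X1 is constant and the end point is (y1, x2, 0, 0)
([exp_field_cst]). The integral of
x1^2 u2 vanishes, so that any multiple of x1^2 u2 may enter a calibration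
without affecting its integral. Let e be the sign of x2, and let m > 0 be such that m |x1| <= 1 along the path. The
calibration with b = e (1 - m^2 x1^2) and a = 0 gives L >= |x2|. After the last
time at which x1 <= y1 / 2, there is room to take a = m y1 / 2 instead, which
improves the bound to L >= |x2| + m y1^2 / 4 ([lift_horizontal_estimate]).
Were L < |x2| + K y1^2, the ellipse would force x1 = O(y1), hence m = 4 K
would be admissible for y1 small, a contradiction. Thus the difference
quotient is at least K near 0 on this half-line, for every K.

The analytic input is that a continuous function with an integrable weak
derivative is a primitive of it ([weak_derivative_primitive]); it is obtained
by testing against C^1 approximations of the indicator of an interval. *)

(** * C^1 approximations of a step *)

Section Step.
Context {R : realType}.
Implicit Types (s k x : R).

Definition ppart x : R := Num.max 0 x.

Definition sqramp x : R := ppart x ^+ 2.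

Lemma ppartP x : (0 <= x /\ ppart x = x) \/ (x <= 0 /\ ppart x = 0).
Proof.
rewrite /ppart; case: (leP 0 x) => [x0|/ltW x0]; [left|right]; split=> //.
Qed.

Lemma continuous_ppart : continuous ppart.
Proof. by move=> x; apply: continuous_max; [exact: cvg_cst|exact: cvg_id]. Qed.

(** The derivative of [sqramp] is 2-Lipschitz, hence a remainder that is
uniform in [x]: differentiability needs no case analysis at the kink. *)
Lemma sqramp_expansion x h :
  `|sqramp (x + h) - sqramp x - 2 * ppart x * h| <= h ^+ 2.
Proof.
rewrite /sqramp ler_norml.
by case: (ppartP x) => -[? ->]; case: (ppartP (x + h)) => -[? ->];
  apply/andP; split; nra.
Qed.

Lemma is_derive_sqramp x : is_derive x 1 sqramp (2 * ppart x).
Proof.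
have H : h^-1 *: (sqramp (h *: 1 + x) - sqramp x) @[h --> 0^'] --> 2 * ppart x.
  apply/cvgrPdist_le => e e0; near=> h.
  have h0 : h != 0 by near: h; exact: nbhs_dnbhs_neq.
  have he : `|h| <= e.
    by near: h; exact: dnbhs0_le.
  apply: le_trans he.
  have := sqramp_expansion x h.
  rewrite /GRing.scale/= mulr1 (addrC h) -normrN.
  set D := _ - sqramp x => H.
  rewrite (_ : - _ = h^-1 * (D - 2 * ppart x * h)); last by field.
  rewrite normrM normfV ler_pdivrMl ?normr_gt0// -expr2 real_normK ?num_real//.
apply: DeriveDef; first by apply/cvg_ex; exists (2 * ppart x).
exact: cvg_lim H.
Unshelve. all: by end_near. Qed.

(** This combination of squared ramps is 0 on the left of 0 and 1 on the right of
1; its derivative is [tent]. *)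
Definition smoothstep x : R :=
  2 * sqramp x - 4 * sqramp (x - 2^-1) + 2 * sqramp (x - 1).

Definition tent x : R := 4 * ppart x - 8 * ppart (x - 2^-1) + 4 * ppart (x - 1).

Lemma smoothstep_le0 x : x <= 0 -> smoothstep x = 0.
Proof.
move=> x0; rewrite /smoothstep /sqramp; case: (ppartP x) => -[? ->];
case: (ppartP (x - 2^-1)) => -[? ->]; case: (ppartP (x - 1)) => -[? ->]; nra.
Qed.

Lemma smoothstep_ge1 x : 1 <= x -> smoothstep x = 1.
Proof.
move=> x0; rewrite /smoothstep /sqramp; case: (ppartP x) => -[? ->];
case: (ppartP (x - 2^-1)) => -[? ->]; case: (ppartP (x - 1)) => -[? ->]; nra.
Qed.

Lemma smoothstep_ge0_le1 x : 0 <= smoothstep x <= 1.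
Proof.
rewrite /smoothstep /sqramp; case: (ppartP x) => -[? ->];
case: (ppartP (x - 2^-1)) => -[? ->]; case: (ppartP (x - 1)) => -[? ->];
apply/andP; split; nra.
Qed.

Lemma tent_ge0 x : 0 <= tent x.
Proof.
rewrite /tent; case: (ppartP x) => -[? ->];
case: (ppartP (x - 2^-1)) => -[? ->]; case: (ppartP (x - 1)) => -[? ->]; lra.
Qed.

Lemma tent_eq0 x : (x <= 0) || (1 <= x) -> tent x = 0.
Proof.
rewrite /tent => /orP[|] ?; case: (ppartP x) => -[? ->];
case: (ppartP (x - 2^-1)) => -[? ->]; case: (ppartP (x - 1)) => -[? ->]; lra.
Qed.

(** For large [k], [step s k] is close to the indicator of x > s, and its
derivative [bump s k] to the Dirac mass at [s]. *)
Definition step s k x : R := smoothstep (k * (x - s)).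

Definition bump s k x : R := k * tent (k * (x - s)).

Lemma is_derive_affine k s c x : is_derive x 1 (fun y => k * (y - s) - c) k.
Proof.
have -> : (fun y => k * (y - s) - c) = k \*: (id - cst s) - cst c.
  by apply/funext => y; rewrite !fctE.
by apply: is_derive_eq; rewrite !subr0 /GRing.scale/= mulr1.
Qed.

Lemma is_derive_step s k x : is_derive x 1 (step s k) (bump s k x).
Proof.
pose r c y := sqramp (k * (y - s) - c).
have dr c : is_derive x 1 (r c) (2 * ppart (k * (x - s) - c) * k).
  apply: is_derive1_comp; last exact: is_derive_affine.
  exact: is_derive_sqramp.
have -> : step s k = 2 \*: r 0 - 4 \*: r 2^-1 + 2 \*: r 1.
  by apply/funext => y; rewrite /step /smoothstep /r !fctE/= subr0.
apply: is_derive_eq; rewrite /GRing.scale/= /bump /tent subr0; ring.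
Qed.

Lemma continuous_bump s k : continuous (bump s k).
Proof.
move=> x; pose r c y := ppart (k * (y - s) - c).
have cr c : {for x, continuous (r c)}.
  apply: continuous_comp; last exact: continuous_ppart.
  apply: cvgB; last exact: cvg_cst.
  by apply: cvgM; [exact: cvg_cst|apply: cvgB; [exact: cvg_id|exact: cvg_cst]].
have -> : bump s k = fun y => k * (4 * r 0 y - 8 * r 2^-1 y + 4 * r 1 y).
  by apply/funext => y; rewrite /bump /tent /r subr0.
apply: cvgM; first exact: cvg_cst.
apply: cvgD; last by apply: cvgM; [exact: cvg_cst|exact: cr].
by apply: cvgB; apply: cvgM; [exact: cvg_cst|exact: cr|exact: cvg_cst|exact: cr].
Qed.

Lemma continuous_step s k : continuous (step s k).
Proof.
move=> x; apply: differentiable_continuous; apply/derivable1_diffP.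
by have [] := is_derive_step s k x.
Qed.

Lemma cvg_step s x : x != s -> step s n.+1%:R x @[n --> \oo] --> ((s < x)%R%:R : R).
Proof.
move=> xs.
have [sx|] := ltP s x; last first.
  rewrite le_eqVlt (negbTE xs)/= => xs'.
  apply: cvg_near_cst; near=> n; rewrite /step smoothstep_le0//.
  by have : (0 : R) < n.+1%:R by []; nra.
apply: cvg_near_cst; near=> n; rewrite /step smoothstep_ge1//.
rewrite -ler_pdivrMr ?subr_gt0// mul1r.
apply: (@le_trans _ _ n%:R); last by rewrite ler_nat.
by near: n; exact: nbhs_infty_ger.
Unshelve. all: by end_near. Qed.

End Step.

(** * Integrable functions on the unit interval *)

Section Integrable01.
Context {R : realType}.
Implicit Types (t : R) (c f g h u : R -> R).

Local Notation mu := (@lebesgue_measure R).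
Local Notation J := [set` `](0 : R), 1[].

Definition int01 f := mu.-integrable J (EFin \o f).

Lemma int01D f g : int01 f -> int01 g -> int01 (fun x => f x + g x).
Proof. by move=> fi gi; exact: (integrableD _ fi gi). Qed.

Lemma int01Z k f : int01 f -> int01 (fun x => k * f x).
Proof. by move=> fi; exact: (integrableZl _ k fi). Qed.

Lemma int01_measurable f : int01 f -> measurable_fun J f.
Proof. by move=> fi; apply/measurable_EFinP; exact: (measurable_int mu). Qed.

Lemma int01_continuous f :
  {within `[0, 1], continuous f} -> int01 f.
Proof.
move=> cf; apply: (@integrableS _ _ _ mu `[0, 1]) => //.
  exact: subset_itv_oo_cc.
by apply: continuous_compact_integrable => //; exact: segment_compact.
Qed.

Lemma L2_01_integrable f : L2_01 f -> int01 f.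
Proof.
move=> [mf f2].
apply: (@le_integrable _ _ _ mu J _ _ (fun x => (1 + f x ^+ 2)%:E)).
- exact: measurable_itv.
- exact/measurable_EFinP.
- move=> x _ /=; rewrite lee_fin (@ger0_norm _ (1 + _)) ?addr_ge0 ?sqr_ge0//.
  rewrite -(real_normK (num_real (f x))).
  by have := normr_ge0 (f x); nra.
- have i1 : int01 (cst 1).
    apply: int01_continuous.
    by apply: continuous_subspaceT => x; exact: cvg_cst.
  have i2 : int01 (fun x => f x ^+ 2).
    apply/integrableP; split.
      by apply/measurable_EFinP; exact: measurable_funX.
    by under eq_integral do rewrite /= ger0_norm ?sqr_ge0//.
  exact: (integrableD _ i1 i2).
Qed.

Lemma int01M c u : {within `[0, 1], continuous c} -> int01 u ->
  int01 (fun x => c x * u x).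
Proof.
move=> cc iu.
have ccn : {within `[0, 1], continuous (fun x => `|c x|)}.
  by move=> x; apply: cvg_norm; exact: cc.
have [m _ cm] := EVT_max ler01 ccn.
apply: (le_integrable _ _ _ (int01Z `|c m| iu)) => //.
  apply/measurable_EFinP; apply: measurable_funM; last exact: int01_measurable.
  by apply: int01_measurable; exact: int01_continuous.
move=> x /= xJ; rewrite lee_fin !normrM normr_id ler_wpM2r// cm//.
by apply: subset_itv_oo_cc.
Qed.

Lemma Rintegral_split_01 h t : int01 h -> 0 <= t <= 1 ->
  \int[mu]_(x in `]0, 1[) h x =
  \int[mu]_(x in `]0, t[) h x + \int[mu]_(x in `]t, 1[) h x.
Proof.
move=> ih /andP[t0 t1]; move: t1; rewrite le_eqVlt => /predU1P[->|t1].
  by rewrite (set_itvoo0 1) Rintegral_set0 addr0.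
have H := @Rintegral_itvB R h (BRight 0) (BLeft 1) t ih.
rewrite -H ?bnd_simp// (@Rintegral_itv_bndo_bndc _ (BRight 0) t); last first.
  by apply: integrableS ih => //; apply: subset_itvl; rewrite bnd_simp ltW.
by rewrite [RHS]addrC subrK.
Qed.

Lemma Rintegral_oo_cc f : continuous f ->
  \int[mu]_(s in `]0, 1[) f s = \int[mu]_(s in `[0, 1]) f s.
Proof.
move=> cf; have ic : mu.-integrable `[0, 1] (EFin \o f).
  apply: continuous_compact_integrable; first exact: segment_compact.
  exact: continuous_subspaceT.
rewrite (@Rintegral_itv_bndo_bndc _ (BRight 0) 1); last first.
  by apply: integrableS ic => //; exact: subset_itv_oo_cc.
rewrite Rintegral_itv_obnd_cbnd//.
by apply: integrableS ic => //; exact: subset_itv_oc_cc.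
Qed.

Lemma continuous_primitive g : int01 g ->
  {within `[0, 1], continuous (fun t => \int[mu]_(x in `]0, t[) g x)}.
Proof.
move=> ig.
have igr : mu.-integrable `[0, 1] (EFin \o (g \_ J)).
  apply: (@integrableS _ _ _ mu setT) => //.
  by rewrite -restrict_EFin; apply/integrable_restrict => //=; rewrite setTI.
have := parameterized_integral_continuous ler01 igr.
apply: subspace_eq_continuous => t; rewrite mem_setE in_itv/= => /andP[t0 t1].
rewrite /from_subspace/= /parameterized_integral.
have igt : mu.-integrable `[0, t] (EFin \o (g \_ J)).
  by apply: integrableS igr => //; apply: subset_itvl; rewrite bnd_simp.
rewrite -Rintegral_itv_obnd_cbnd; last first.
  by apply: integrableS igt => //; exact: subset_itv_oc_cc.
rewrite -Rintegral_itv_bndo_bndc; last first.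
  by apply: integrableS igt => //; exact: subset_itv_oo_cc.
apply: eq_Rintegral => x; rewrite mem_setE in_itv/= => /andP[x0 xt].
by rewrite patchE mem_setE in_itv/= x0 (lt_le_trans xt t1).
Qed.

Lemma constant_on_01 h (a : R) : {within `[0, 1], continuous h} ->
  (forall t, 0 < t < 1 -> h t = a) -> forall t, 0 <= t <= 1 -> h t = a.
Proof.
move=> /(continuous_within_itvP _ (@ltr01 R))[_ h0 h1] hc t.
have e0 : h 0 = a.
  apply: (cvg_unique _ h0) => //; apply: cvg_near_cst; near=> x.
  by apply: hc; apply/andP; split; near: x; [exact: nbhs_right_gt|exact: nbhs_right_lt].
have e1 : h 1 = a.
  apply: (cvg_unique _ h1) => //; apply: cvg_near_cst; near=> x.
  by apply: hc; apply/andP; split; near: x; [exact: nbhs_left_gt|exact: nbhs_left_lt].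
move=> /andP[]; rewrite le_eqVlt => /predU1P[<-//|t0].
by rewrite le_eqVlt => /predU1P[->//|t1]; apply: hc; rewrite t0.
Unshelve. all: by end_near. Qed.

Lemma ae_imply (P Q : R -> Prop) : (forall s, P s -> Q s) ->
  {ae mu, forall s, P s} -> {ae mu, forall s, Q s}.
Proof.
move=> PQ [N [mN N0 sN]]; exists N; split=> // s /= nQ.
by apply: sN => /= /PQ.
Qed.

Lemma ae_eq_Rintegral01 t f g : 0 <= t <= 1 -> int01 f -> int01 g ->
  {ae mu, forall s, s \in `]0, 1[ -> f s = g s} ->
  \int[mu]_(s in `]0, t[) f s = \int[mu]_(s in `]0, t[) g s.
Proof.
move=> /andP[t0 t1] fi gi fg; congr fine.
have sub : [set` `]0, t[] `<=` J by apply: subset_itvl; rewrite bnd_simp.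
apply: ae_eq_integral => //.
- by apply: (measurable_int mu); apply: integrableS fi.
- by apply: (measurable_int mu); apply: integrableS gi.
- by apply: ae_imply fg => s fgs st; congr EFin; apply: fgs; exact: sub.
Qed.

End Integrable01.

(** * Weak derivatives and primitives *)

Section Primitive.
Context {R : realType}.
Implicit Types (s t k x : R) (f g : R -> R).

Local Notation mu := (@lebesgue_measure R).
Local Notation J := [set` `](0 : R), 1[].

(** The difference of two steps approximates the indicator of [s, t]; the last
hypothesis keeps its support away from 1. *)
Lemma test_function_step s t k : 0 < s -> s <= t -> 0 < k -> t + k^-1 < 1 ->
  test_function (fun x => step s k x - step t k x) /\
  derive1 (fun x => step s k x - step t k x) = (fun x => bump s k x - bump t k x).
Proof.
move=> s0 st k0 tk.
have dphi x : is_derive x 1 (step s k - step t k) (bump s k x - bump t k x).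
  by apply: is_deriveB; exact: is_derive_step.
have D1 : derive1 (fun x => step s k x - step t k x) = (fun x => bump s k x - bump t k x).
  by apply/funext => x; rewrite derive1E; have := dphi x => -[].
have sub : tsupport (fun x => step s k x - step t k x) `<=` `[s, t + k^-1].
  have /closure_id -> : closed `[s, t + k^-1] by exact: itv_closed.
  apply: closure_subset => x /=; rewrite in_itv/=; apply: contraNT.
  rewrite negb_and -!ltNge => /orP[xs|xt].
    rewrite /step !smoothstep_le0 ?subrr//; nra.
  have kk : k * k^-1 = 1 by rewrite divff// gt_eqF.
  rewrite /step !smoothstep_ge1 ?subrr//; nra.
split=> //; split.
- by move=> x; have := dphi x => -[].
- by rewrite D1 => x; apply: cvgB; exact: continuous_bump.
- apply: (subclosed_compact _ (@segment_compact _ s (t + k^-1))) sub.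
  exact: closed_closure.
- apply: (subset_trans sub); apply: subset_itv; rewrite bnd_simp//.
Qed.

Lemma Rintegral_bump s k : 0 < s -> 0 < k -> s + k^-1 < 1 ->
  \int[mu]_(x in `]0, 1[) bump s k x = 1.
Proof.
move=> s0 k0 sk.
have kk : k * k^-1 = 1 by rewrite divff// gt_eqF.
have cb : continuous (bump s k) by exact: continuous_bump.
have ds x : derivable (step s k) x 1 by have [] := is_derive_step s k x.
have cs : continuous (step s k) by exact: continuous_step.
have F : (\int[mu]_(x in `[0%R, 1%R]) (bump s k x)%:E =
    (step s k 1)%:E - (step s k 0)%:E)%E.
  apply: continuous_FTC2 => //.
  - exact: continuous_subspaceT.
  - split=> //.
    + by apply: cvg_at_right_filter; exact: cs.
    + by apply: cvg_at_left_filter; exact: cs.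
  - by move=> x _; rewrite derive1E; have [] := is_derive_step s k x.
have k1 : 1 <= k * (1 - s) by rewrite -kk ler_pM2l//; lra.
rewrite Rintegral_oo_cc// /Rintegral F /step smoothstep_ge1// smoothstep_le0; last by nra.
by rewrite -EFinB subr0.
Qed.

Lemma int01_bumpM f s k : {within `[0, 1], continuous f} ->
  int01 (fun x => f x * bump s k x).
Proof.
move=> cf; apply: int01M => //; apply: int01_continuous.
by apply: continuous_subspaceT; exact: continuous_bump.
Qed.

(** The bump has mass 1 and lives on [s, s + 1/k], where [f] is within [e] of
f(s). *)
Lemma cvg_Rintegral_bump f s : {within `[0, 1], continuous f} -> 0 < s < 1 ->
  \int[mu]_(x in `]0, 1[) (f x * bump s n.+1%:R x) @[n --> \oo] --> f s.
Proof.
move=> cf /andP[s0 s1].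
have cfs : {for s, continuous f}.
  have [+ _ _] := (continuous_within_itvP f (@ltr01 R)).1 cf.
  by apply; rewrite in_itv/= s0.
apply/cvgrPdist_le => e e0.
have := cfs; move/cvgrPdist_le => /(_ e e0)[d /= d0 Hd].
have m0 : 0 < Num.min d (1 - s) by rewrite lt_min d0/= subr_gt0.
near=> n.
have : n.+1%:R^-1 < Num.min d (1 - s).
  by near: n; exact: (near_infty_natSinv_lt (PosNum m0)).
have k0 : (0 : R) < n.+1%:R by rewrite ltr0n.
move: (n.+1%:R : R) k0 => k k0 kd.
move: kd; rewrite lt_min => /andP[kd ks].
have ib : int01 (bump s k).
  apply: int01_continuous; apply: continuous_subspaceT.
  exact: continuous_bump.
have ic c : int01 (fun x => c * bump s k x) by exact: int01Z.
have ifb : int01 (fun x => f x * bump s k x) by exact: int01_bumpM.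
have I1 : \int[mu]_(x in `]0, 1[) bump s k x = 1.
  by apply: Rintegral_bump => //; lra.
have E c : \int[mu]_(x in `]0, 1[) (c * bump s k x) = c.
  by rewrite RintegralZl// I1 mulr1.
have bd x : (f s - e) * bump s k x <= f x * bump s k x <= (f s + e) * bump s k x.
  have b0 : 0 <= bump s k x by rewrite mulr_ge0 ?tent_ge0// ltW.
  have [xs|xs] := boolP ((k * (x - s) <= 0) || (1 <= k * (x - s))).
    by rewrite /bump tent_eq0// !mulr0 !lexx.
  move: xs; rewrite negb_or -!ltNge => /andP[xs sx].
  have {}sx : x - s < k^-1 by rewrite -(ltr_pM2l k0) divff// gt_eqF.
  rewrite pmulr_rgt0// in xs.
  have := Hd x; rewrite /ball_/= distrC gtr0_norm// => /(_ (lt_trans sx kd)).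
  rewrite ler_norml => /andP[? ?].
  by apply/andP; split; apply: ler_wpM2r => //; lra.
have L : (f s - e) <= \int[mu]_(x in `]0, 1[) (f x * bump s k x).
  rewrite -[leLHS]E.
  apply: (@le_Rintegral _ _ _ mu J) => //; [exact: ic|move=> x _].
  by have /andP[] := bd x.
have U : \int[mu]_(x in `]0, 1[) (f x * bump s k x) <= f s + e.
  rewrite -[leRHS]E.
  apply: (@le_Rintegral _ _ _ mu J) => //; [exact: ic|move=> x _].
  by have /andP[] := bd x.
rewrite ler_norml; apply/andP; split; lra.
Unshelve. all: by end_near. Qed.

Lemma int01_stepM g s k : int01 g -> int01 (fun x => g x * step s k x).
Proof.
move=> ig; under eq_fun do rewrite mulrC.
by apply: int01M => //; apply: continuous_subspaceT; exact: continuous_step.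
Qed.

Lemma cvg_Rintegral_step g s : int01 g -> 0 <= s ->
  \int[mu]_(x in `]0, 1[) (g x * step s n.+1%:R x) @[n --> \oo] -->
  \int[mu]_(x in `]s, 1[) g x.
Proof.
move=> ig s0.
have mg : measurable_fun J (EFin \o g) by exact: (measurable_int mu).
have -> : \int[mu]_(x in `]s, 1[) g x = \int[mu]_(x in `]0, 1[) (g x * (s < x)%R%:R).
  have -> : [set` `]s, 1[] = J `&` [set` `]s, +oo[].
    apply/seteqP; split=> x /=; rewrite !in_itv/= ?andbT.
      by move=> /andP[sx ->]; rewrite sx (le_lt_trans s0).
    by move=> [/andP[_ ->] ->].
  rewrite Rintegral_mkcondr; apply: eq_Rintegral => x _.
  by rewrite patchE mem_setE in_itv/= andbT; case: ifP; rewrite ?mulr1 ?mulr0.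
have mlim : measurable_fun J (fun x => (g x * (s < x)%R%:R)%:E).
  apply/measurable_EFinP; apply: measurable_funM; first exact/measurable_EFinP.
  rewrite [X in measurable_fun _ X](_ : _ = \1_(`]s, +oo[ : set R)); last first.
    by apply/funext => x; rewrite indicE mem_setE in_itv/= andbT.
  exact: measurable_indic.
have pointwise : {ae mu, forall x, J x ->
    (g x * step s n.+1%:R x)%:E @[n --> \oo] --> (g x * (s < x)%R%:R)%:E}.
  exists [set s]; split=> //; first exact: lebesgue_measure_set1.
  move=> x /=; apply: contra_notP => /eqP xs Jx.
  apply: cvg_EFin; first exact: nearW.
  by apply: cvgM; [exact: cvg_cst|exact: cvg_step].
have dominated : {ae mu, forall x n, J x ->
    (`|(g x * step s n.+1%:R x)%:E| <= `|(g x)%:E|)%E}.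
  apply: aeW => x n _; rewrite /= lee_fin normrM.
  have /andP[h0 h1] := smoothstep_ge0_le1 (n.+1%:R * (x - s)).
  rewrite (ger0_norm (x := step s _ x))//.
  by have := normr_ge0 (g x); rewrite /step; nra.
have [ilim _ H] := @dominated_convergence _ _ R mu J (measurable_itv _)
  (fun n x => (g x * step s n.+1%:R x)%:E) _ _
  (fun n => measurable_int mu (int01_stepM s n.+1%:R ig)) mlim
  pointwise (integrable_abse ig) dominated.
apply: fine_cvg; rewrite fineK; last exact: integrable_fin_num.
exact: H.
Qed.

(** Testing against steps at [s] and [t] and letting them sharpen turns the weak
derivative into f(s) - f(t) = - (the integral of [g] from [s] to [t]), by
continuity of [f] on one side and dominated convergence on the other. *)
Lemma weak_derivative_primitive f g :
  {within `[0, 1], continuous f} -> int01 g ->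
  weak_derivative f g ->
  forall t, 0 <= t <= 1 -> f t = f 0 + \int[mu]_(x in `]0, t[) g x.
Proof.
move=> cf ig wfg.
pose F t := \int[mu]_(x in `]0, t[) g x.
have key s t : 0 < s -> s < t -> t < 1 -> f t - F t = f s - F s.
  move=> s0 st t1.
  have s1 := lt_trans st t1; have t0 := lt_trans s0 st.
  have bs : 0 < s < 1 by rewrite s0.
  have bt : 0 < t < 1 by rewrite t1 t0.
  have L1 : \int[mu]_(x in `]0, 1[) (f x * bump s n.+1%:R x) -
      \int[mu]_(x in `]0, 1[) (f x * bump t n.+1%:R x) @[n --> \oo] --> f s - f t.
    by apply: cvgB; exact: cvg_Rintegral_bump.
  have L2 : - (\int[mu]_(x in `]0, 1[) (g x * step s n.+1%:R x) -
      \int[mu]_(x in `]0, 1[) (g x * step t n.+1%:R x)) @[n --> \oo] -->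
      - (\int[mu]_(x in `]s, 1[) g x - \int[mu]_(x in `]t, 1[) g x).
    by apply: cvgN; apply: cvgB; apply: cvg_Rintegral_step => //; exact: ltW.
  have E : f s - f t = - (\int[mu]_(x in `]s, 1[) g x - \int[mu]_(x in `]t, 1[) g x).
    apply: (cvg_unique _ L1) => //; apply: cvg_trans L2; apply: near_eq_cvg.
    near=> n.
    have k0 : (0 : R) < n.+1%:R by rewrite ltr0n.
    have k1 : t + n.+1%:R^-1 < 1.
      rewrite addrC -ltrBrDr; near: n.
      have m0 : 0 < 1 - t by rewrite subr_gt0.
      exact: (near_infty_natSinv_lt (PosNum m0)).
    have [tf D] := test_function_step s0 (ltW st) k0 k1.
    have := wfg _ tf; rewrite D /=.
    under eq_Rintegral do rewrite mulrBr.
    rewrite RintegralB//; [|exact: int01_bumpM|exact: int01_bumpM].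
    move=> ->; congr (- _).
    under [RHS]eq_Rintegral do rewrite mulrBr.
    by rewrite RintegralB//; exact: int01_stepM.
  have := @Rintegral_split_01 _ g s ig; rewrite (ltW s0) (ltW s1) => /(_ isT).
  have := @Rintegral_split_01 _ g t ig; rewrite (ltW t0) (ltW t1) => /(_ isT).
  rewrite -/(F s) -/(F t); move: E.
  move: (F s) (F t) (\int[mu]_(x in `]s, 1[) g x) => Fs Ft Is.
  move: (\int[mu]_(x in `]t, 1[) g x) (\int[mu]_(x in `]0, 1[) g x) => It I.
  by clear; lra.
have F0 : F 0 = 0 by rewrite /F (set_itvoo0 0) Rintegral_set0.
have cF : {within `[0, 1], continuous (fun t => f t - F t)}.
  by move=> t; apply: cvgB; [exact: cf|exact: continuous_primitive].
have C : forall t, 0 < t < 1 -> f t - F t = f 2^-1 - F 2^-1.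
  move=> t /andP[t0 t1]; case: (ltgtP t 2^-1) => [h|h|->//].
    by rewrite (key t 2^-1)//; lra.
  by apply: key => //; lra.
move=> t ht.
have := constant_on_01 cF C ht; have := constant_on_01 cF C (t := 0).
rewrite lexx ler01 F0 -/(F t) => /(_ isT).
by move: (F t) (F 2^-1) => Ft Fh; clear; lra.
Unshelve. all: by end_near. Qed.

End Primitive.

(** * Planar projection of a horizontal path *)

Section Lift.
Context {R : realType}.
Implicit Types (s t : R) (f u xi : R -> R).

Local Notation mu := (@lebesgue_measure R).

Definition speed u1 u2 s := Num.sqrt (u1 s ^+ 2 + u2 s ^+ 2).

Lemma int01_speed u1 u2 : int01 u1 -> int01 u2 -> int01 (speed u1 u2).
Proof.
move=> i1 i2; have iN u : int01 u -> int01 (fun x => `|u x|).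
  by move=> iu; exact: (integrable_abse iu).
apply: (le_integrable _ _ _ (int01D (iN _ i1) (iN _ i2))) => //.
  apply/measurable_EFinP.
  apply: (@measurableT_comp _ _ _ _ _ _ (@Num.sqrt R)).
    by apply: continuous_measurable_fun; exact: sqrt_continuous.
  by apply: measurable_funD; apply: measurable_funX; exact: int01_measurable.
move=> x _ /=; rewrite lee_fin /speed ger0_norm ?sqrtr_ge0//.
rewrite -[leRHS]sqrtr_sqr ler_wsqrtr//.
rewrite -(real_normK (num_real (u1 x))) -(real_normK (num_real (u2 x))).
by have := normr_ge0 (u1 x); have := normr_ge0 (u2 x); nra.
Qed.

Definition path_length u1 u2 : R := \int[mu]_(s in `]0, 1[) speed u1 u2 s.

Lemma horizontal_lengthE u1 u2 : int01 u1 -> int01 u2 ->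
  horizontal_length u1 u2 = (path_length u1 u2)%:E.
Proof.
move=> i1 i2; rewrite /path_length /Rintegral fineK//; apply: integrable_fin_num => //.
exact: int01_speed.
Qed.

(** What the estimates retain of a horizontal path from the origin to a point
(y1, y2, _, y4): the controls and the first coordinate [xi]. *)
Record engel_lift xi u1 u2 (y1 y2 y4 : R) : Prop := EngelLift {
  lift_int1 : int01 u1;
  lift_int2 : int01 u2;
  lift_cont : {within `[0, 1], continuous xi};
  lift_xi : forall t, 0 <= t <= 1 -> xi t = \int[mu]_(s in `]0, t[) u1 s;
  lift_y1 : xi 1 = y1;
  lift_y2 : \int[mu]_(s in `]0, 1[) u2 s = y2;
  lift_y4 : \int[mu]_(s in `]0, 1[) (xi s ^+ 2 / 2 * u2 s) = y4 }.

Lemma int01_height xi u : {within `[0, 1], continuous xi} -> int01 u ->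
  int01 (fun s => xi s ^+ 2 / 2 * u s).
Proof.
move=> cxi iu; apply: int01M => // s; apply: cvgM; last exact: cvg_cst.
by apply: cvgM; exact: cxi.
Qed.

Lemma within_coord_continuous (gamma : R -> 'rV[R]_4) i :
  {within `[0, 1], continuous gamma} ->
  {within `[0, 1], continuous (fun t => gamma t ord0 i)}.
Proof.
move=> cg t; apply: (cvg_comp gamma (fun M : 'rV[R]_4 => M ord0 i)); first exact: cg.
exact: coord_continuous.
Qed.

Lemma horizontal_path_lift gamma u1 u2 (y1 y2 y3 y4 : R) :
  horizontal_path gamma u1 u2 -> gamma 0 = 0 -> gamma 1 = vec4 y1 y2 y3 y4 ->
  engel_lift (fun t => gamma t ord0 ord0) u1 u2 y1 y2 y4.
Proof.
move=> [L1 L2 [dgamma [cg dg] ae]] g0 g1.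
have i1 := L2_01_integrable L1; have i2 := L2_01_integrable L2.
have cx i := within_coord_continuous (i := i) cg.
have id i : int01 (fun s => dgamma s ord0 i).
  by have [_ L _] := dg i; exact: L2_01_integrable.
have prim i t : 0 <= t <= 1 ->
    gamma t ord0 i = \int[mu]_(s in `]0, t[) (dgamma s ord0 i).
  move=> ht; have [_ _ w] := dg i.
  by have := weak_derivative_primitive (cx i) (id i) w ht; rewrite g0 mxE add0r.
pose xi t := gamma t ord0 ord0.
have i4 : int01 (fun s => xi s ^+ 2 / 2 * u2 s).
  by apply: int01_height => //; exact: cx.
have h11 : 0 <= (1 : R) <= 1 by rewrite lexx ler01.
split => //.
- move=> t ht; rewrite (prim _ _ ht); apply: ae_eq_Rintegral01 => //.
  apply: ae_imply ae => s H /H ->; rewrite !mxE/=; ring.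
- by rewrite g1 mxE.
- have := prim (Ordinal (isT : 1 < 4)%N) 1 h11.
  rewrite g1 mxE/= => ->; apply: ae_eq_Rintegral01 => //.
  apply: ae_imply ae => s H /H ->; rewrite !mxE/=; ring.
- have := prim (Ordinal (isT : 3 < 4)%N) 1 h11.
  rewrite g1 mxE/= => ->; apply: ae_eq_Rintegral01 => //.
  apply: ae_imply ae => s H /H ->; rewrite !mxE/= /xi; ring.
Qed.

End Lift.

(** * Calibrations *)

Section LowerBounds.
Context {R : realType}.
Implicit Types (s t m : R) (f g h k u xi : R -> R).

Local Notation mu := (@lebesgue_measure R).
Local Notation J := [set` `](0 : R), 1[].

Lemma le_speed a b p q : a ^+ 2 + b ^+ 2 <= 1 ->
  a * p + b * q <= Num.sqrt (p ^+ 2 + q ^+ 2) :> R.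
Proof.
move=> ab; apply: (le_trans (ler_norm _)).
rewrite -sqrtr_sqr ler_wsqrtr//.
have : 0 <= (a * q - b * p) ^+ 2 by exact: sqr_ge0.
have : 0 <= (1 - (a ^+ 2 + b ^+ 2)) * (p ^+ 2 + q ^+ 2).
  by rewrite mulr_ge0 ?subr_ge0// addr_ge0 ?sqr_ge0.
by nra.
Qed.

Lemma calibration_bound f k1 k2 t : 0 <= t <= 1 ->
  int01 f -> int01 k1 -> int01 k2 ->
  (forall s, 0 < s < 1 -> s < t -> k1 s <= f s) ->
  (forall s, 0 < s < 1 -> t < s -> k2 s <= f s) ->
  \int[mu]_(s in `]0, t[) k1 s + \int[mu]_(s in `]t, 1[) k2 s <=
  \int[mu]_(s in `]0, 1[) f s.
Proof.
move=> ht fi i1 i2 le1 le2; rewrite (Rintegral_split_01 fi ht).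
move: ht => /andP[t0 t1].
have sub0 : [set` `]0, t[] `<=` J by apply: subset_itvl; rewrite bnd_simp.
have sub1 : [set` `]t, 1[] `<=` J by apply: subset_itvr; rewrite bnd_simp.
apply: lerD; apply: le_Rintegral => //.
- by apply: integrableS i1.
- by apply: integrableS fi.
- move=> s /= sI; have /= := sub0 _ sI; rewrite in_itv/= => sJ.
  by apply: le1 => //; move: sI; rewrite in_itv/= => /andP[].
- by apply: integrableS i2.
- by apply: integrableS fi.
- move=> s /= sI; have /= := sub1 _ sI; rewrite in_itv/= => sJ.
  by apply: le2 => //; move: sI; rewrite in_itv/= => /andP[].
Qed.

Lemma Rintegral_lin t f g a b : 0 <= t <= 1 -> int01 f -> int01 g ->
  \int[mu]_(s in `]0, t[) (a * f s + b * g s) =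
    a * \int[mu]_(s in `]0, t[) f s + b * \int[mu]_(s in `]0, t[) g s /\
  \int[mu]_(s in `]t, 1[) (a * f s + b * g s) =
    a * \int[mu]_(s in `]t, 1[) f s + b * \int[mu]_(s in `]t, 1[) g s.
Proof.
move=> /andP[t0 t1] fi gi.
have sub0 : [set` `]0, t[] `<=` J by apply: subset_itvl; rewrite bnd_simp.
have sub1 : [set` `]t, 1[] `<=` J by apply: subset_itvr; rewrite bnd_simp.
have r0 h : int01 h -> mu.-integrable `]0, t[ (EFin \o h).
  by move=> hi; apply: integrableS hi.
have r1 h : int01 h -> mu.-integrable `]t, 1[ (EFin \o h).
  by move=> hi; apply: integrableS hi.
split.
- rewrite RintegralD//; [|exact: r0 (int01Z _ _)|exact: r0 (int01Z _ _)].
  by rewrite !RintegralZl//; exact: r0.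
- rewrite RintegralD//; [|exact: r1 (int01Z _ _)|exact: r1 (int01Z _ _)].
  by rewrite !RintegralZl//; exact: r1.
Qed.

(** The planar path from the origin to (y1, y2) passes through a point of
abscissa [xi t]; reflecting the part after [t] in the vertical line through
that point gives a path of the same length to (2 xi(t) - y1, y2). *)
Lemma lift_height xi u1 u2 (y1 y2 y4 : R) t : engel_lift xi u1 u2 y1 y2 y4 ->
  0 <= t <= 1 ->
  (2 * xi t - y1) ^+ 2 + y2 ^+ 2 <= path_length u1 u2 ^+ 2.
Proof.
move=> [i1 i2 cxi xiE e1 e2 _] ht.
set L := path_length u1 u2.
have cal a b : a ^+ 2 + b ^+ 2 <= 1 -> a * (2 * xi t - y1) + b * y2 <= L.
  move=> ab.
  have := @calibration_bound _ (fun s => a * u1 s + b * u2 s)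
    (fun s => - a * u1 s + b * u2 s) _ ht (int01_speed i1 i2)
    (int01D (int01Z _ i1) (int01Z _ i2)) (int01D (int01Z _ i1) (int01Z _ i2)).
  have [-> _] := Rintegral_lin a b ht i1 i2.
  have [_ ->] := Rintegral_lin (- a) b ht i1 i2.
  rewrite -/(path_length u1 u2) -/L => H.
  have {}H := H (fun s _ _ => le_speed _ _ ab) _.
  have : (- a) ^+ 2 + b ^+ 2 <= 1 by rewrite sqrrN.
  move=> /le_speed ab'; have {}H := H (fun s _ _ => ab' _ _).
  have S1 := Rintegral_split_01 i1 ht.
  have S2 := Rintegral_split_01 i2 ht.
  have E1 := xiE _ ht.
  have E2 : y1 = \int[mu]_(s in `]0, 1[) u1 s by rewrite -e1 xiE// lexx ler01.
  move: H S1 S2; rewrite -E1 -E2 e2.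
  move: (\int[mu]_(s in `]t, 1[) u1 s) (\int[mu]_(s in `]t, 1[) u2 s).
  move: (\int[mu]_(s in `]0, t[) u2 s) => p q r H S1 S2.
  have -> : a * (2 * xi t - y1) + b * y2 =
    a * xi t + b * p + (- a * q + b * r) by rewrite S1 S2; ring.
  exact: H.
(* The best direction (a, b) is that of the reflected end point. *)
set A := 2 * xi t - y1 in cal *.
pose N := Num.sqrt (A ^+ 2 + y2 ^+ 2).
have NN : N ^+ 2 = A ^+ 2 + y2 ^+ 2 by rewrite sqr_sqrtr// addr_ge0 ?sqr_ge0.
have N0 : 0 <= N by exact: sqrtr_ge0.
have [N00|Nn0] := eqVneq N 0; first by rewrite -NN N00 expr0n/= sqr_ge0.
have NL : N <= L.
  have /cal : (A / N) ^+ 2 + (y2 / N) ^+ 2 <= 1.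
    by rewrite !expr_div_n -mulrDl -NN divff// expf_neq0.
  rewrite (_ : _ + _ = (A ^+ 2 + y2 ^+ 2) / N); last by ring.
  by rewrite -NN expr2 mulfK.
by rewrite -NN ler_sqr// nnegrE (le_trans N0).
Qed.

Lemma path_length_ge xi u1 u2 (y1 y2 y4 : R) : engel_lift xi u1 u2 y1 y2 y4 ->
  `|y2| <= path_length u1 u2.
Proof.
move=> l; have L0 : 0 <= path_length u1 u2.
  by apply: Rintegral_ge0 => s _; exact: sqrtr_ge0.
have := lift_height l (t := 0); rewrite lexx ler01 => /(_ isT) h.
rewrite -ler_sqr ?nnegrE// real_normK ?num_real//.
by apply: le_trans h; rewrite lerDr sqr_ge0.
Qed.

(** For y1 = 0, [lift_height] reads 4 xi^2 <= L^2 - y2^2; this is integrated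
against |u2| <= |u|. *)
Lemma lift_closed_estimate xi u1 u2 (y2 y4 : R) : engel_lift xi u1 u2 0 y2 y4 ->
  8 * `|y4| <= (path_length u1 u2 ^+ 2 - y2 ^+ 2) * path_length u1 u2.
Proof.
move=> l; set L := path_length u1 u2; have [i1 i2 cxi _ _ _ e4] := l.
have h s : 0 <= s <= 1 -> 4 * xi s ^+ 2 <= L ^+ 2 - y2 ^+ 2.
  by move=> /(lift_height l); rewrite -/L subr0; move: (L) => ?; clear; nra.
have i4 := int01_height cxi i2.
have H e : e ^+ 2 = 1 -> e * y4 <= (L ^+ 2 - y2 ^+ 2) / 8 * L.
  move=> ee; rewrite -e4 {2}/L /path_length -!RintegralZl//; last exact: int01_speed.
  apply: le_Rintegral => //; [exact: int01Z|exact: (int01Z _ (int01_speed i1 i2))|].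
  move=> s /=; rewrite in_itv/= => /andP[s0 s1]; rewrite -/L.
  have hs : 4 * xi s ^+ 2 <= L ^+ 2 - y2 ^+ 2 by apply: h; rewrite !ltW.
  have : 0 * u1 s + e * u2 s <= speed u1 u2 s by apply: le_speed; rewrite ee expr0n add0r.
  have : 0 <= speed u1 u2 s by exact: sqrtr_ge0.
  have := sqr_ge0 (xi s); rewrite mul0r add0r.
  move: (speed u1 u2 s) hs => v; set d := L ^+ 2 - y2 ^+ 2; set q := xi s ^+ 2.
  move=> hd q0 v0 hv.
  have : q / 2 * (e * u2 s) <= q / 2 * v by rewrite ler_wpM2l// divr_ge0.
  have : 0 <= (d - 4 * q) * v by rewrite mulr_ge0// subr_ge0.
  by clear; nra.
have P1 := H 1 (expr1n _ _); have P2 : -1 * y4 <= (L ^+ 2 - y2 ^+ 2) / 8 * L.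
  by apply: H; rewrite sqrrN expr1n.
rewrite mul1r in P1; rewrite mulN1r in P2.
have : `|y4| <= (L ^+ 2 - y2 ^+ 2) / 8 * L by rewrite ler_norml lerNl P1 P2.
by move: (L) => Lv; clear; lra.
Qed.

(** The time [t] is the supremum of the closed set where xi <= v. *)
Lemma last_passage xi (v : R) : {within `[0, 1], continuous xi} -> xi 0 <= v ->
  exists2 t, 0 <= t <= 1 & xi t <= v /\ forall s, t < s <= 1 -> v < xi s.
Proof.
move=> cxi x0v; pose E := [set t | 0 <= t <= 1 /\ xi t <= v].
have E0 : E 0 by rewrite /E /= lexx ler01.
have ubE : has_ubound E by exists 1 => t [/andP[]].
have supE := ub_le_sup ubE.
have t0 : 0 <= sup E by exact: supE.
have t1 : sup E <= 1 by apply: ge_sup; [exists 0|move=> t [/andP[]]].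
exists (sup E); first by rewrite t0.
split; last first.
  move=> s /andP[ts s1]; rewrite ltNge; apply/negP => xsv.
  have Es : E s by split=> //; rewrite s1 (le_trans t0)// ltW.
  by have := lt_le_trans ts (supE _ Es); rewrite ltxx.
rewrite leNgt; apply/negP => vx.
have := closure_sup (ex_intro _ 0 E0) ubE.
have /subspace_continuousP/(_ (sup E)) := cxi.
rewrite /= in_itv/= t0 t1 => /(_ isT)/cvgr_gt/(_ _ vx) N clE.
have [t [[ht xt] /(_ _)]] := clE _ N.
by rewrite /= in_itv/= ht => /(_ isT); rewrite ltNge xt.
Qed.

(** With q = m^2 xi^2 in [0, 1], the calibration b = +-(1 - q), a = 0 leaves room
for any a with a^2 <= q, since (1 - q)^2 + q <= 1. This is spent on
a = m y1 / 2 while xi >= y1 / 2, that is, on a horizontal displacement of at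
least y1 / 2. The term m^2 xi^2 u2 integrates to zero because y4 = 0. *)
Lemma lift_horizontal_estimate xi u1 u2 (y1 y2 : R) m :
  engel_lift xi u1 u2 y1 y2 0 -> 0 < y1 -> 0 < m ->
  (forall t, 0 <= t <= 1 -> m ^+ 2 * xi t ^+ 2 <= 1) ->
  `|y2| + m * y1 ^+ 2 / 4 <= path_length u1 u2.
Proof.
move=> [i1 i2 cxi xiE e1 e2 e4] y10 m0 hm.
have h0 : 0 <= (0 : R) <= 1 by rewrite lexx ler01.
have h1 : 0 <= (1 : R) <= 1 by rewrite lexx ler01.
have x00 : xi 0 = 0 by rewrite xiE// (set_itvoo0 0) Rintegral_set0.
have [t ht [xt xit]] : exists2 t, 0 <= t <= 1 & xi t <= y1 / 2 /\
    forall s, t < s <= 1 -> y1 / 2 < xi s.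
  by apply: last_passage => //; rewrite x00 divr_ge0// ltW.
have i4 := int01_height cxi i2.
pose e : R := if 0 <= y2 then 1 else -1.
have ee : e ^+ 2 = 1 by rewrite /e; case: ifP => _; rewrite ?expr1n ?sqrrN ?expr1n.
have ey : e * y2 = `|y2|.
  rewrite /e; case: ifP => [y0|/negbT]; first by rewrite mul1r ger0_norm.
  by rewrite -ltNge mulN1r => y0; rewrite ltr0_norm.
pose k s := e * u2 s + - (2 * m ^+ 2 * e) * (xi s ^+ 2 / 2 * u2 s).
pose a := m * (y1 / 2).
have ik : int01 k by apply: int01D; exact: int01Z.
have H := @calibration_bound _ k (fun s => a * u1 s + 1 * k s) _ ht
   (int01_speed i1 i2) ik (int01D (int01Z _ i1) (int01Z _ ik)).
have q1 s : 0 < s < 1 -> 0 <= m ^+ 2 * xi s ^+ 2 <= 1.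
  move=> /andP[s0 s1]; apply/andP; split; first by rewrite mulr_ge0 ?sqr_ge0.
  by apply: hm; rewrite !ltW.
have kE s : k s = e * (1 - m ^+ 2 * xi s ^+ 2) * u2 s by rewrite /k; field.
have {}H : \int[mu]_(s in `]0, t[) k s +
    \int[mu]_(s in `]t, 1[) (a * u1 s + 1 * k s) <= path_length u1 u2.
  apply: H => s hs st; rewrite kE; have /andP[] := q1 s hs.
    move=> q0 q1'; rewrite -[leLHS]add0r -(mul0r (u1 s)); apply: le_speed.
    rewrite exprMn ee; move: q0 q1'; move: (m ^+ 2 * xi s ^+ 2) => q.
    by clear; nra.
  move=> q0 q1'; rewrite mul1r; apply: le_speed.
  rewrite [(e * _) ^+ 2]exprMn ee.
  have ys : y1 / 2 < xi s by apply: xit; case/andP: hs => _ /ltW ->; rewrite st.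
  have yy : 0 <= y1 / 2 by rewrite divr_ge0// ltW.
  have : a ^+ 2 <= m ^+ 2 * xi s ^+ 2.
    by rewrite /a exprMn ler_wpM2l ?sqr_ge0// ler_sqr ?nnegrE// ?ltW// (le_lt_trans yy).
  move: q0 q1'; move: (m ^+ 2 * xi s ^+ 2) (a ^+ 2) => q b.
  by clear; nra.
apply: le_trans H.
have [_ ->] := Rintegral_lin a 1 ht i1 ik.
have S1 := Rintegral_split_01 i1 ht.
have Sk := Rintegral_split_01 ik ht.
have E1 := xiE _ ht.
have E2 : y1 = \int[mu]_(s in `]0, 1[) u1 s by rewrite -e1 xiE.
have Ek : \int[mu]_(s in `]0, 1[) k s = `|y2|.
  have [+ _] := Rintegral_lin e (- (2 * m ^+ 2 * e)) h1 i2 i4.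
  by rewrite e2 e4 mulr0 addr0 ey.
move: S1 Sk; rewrite -E1 -E2 Ek mul1r.
move: (\int[mu]_(s in `]t, 1[) u1 s) (\int[mu]_(s in `]t, 1[) k s) => q r.
move: (\int[mu]_(s in `]0, t[) k s) => p S1 ->.
have -> : p + (a * q + r) = p + r + a * q by ring.
rewrite lerD2l (_ : m * y1 ^+ 2 / 4 = a * (y1 / 2)); last by rewrite /a; field.
rewrite ler_wpM2l//; first by rewrite /a mulr_ge0 ?divr_ge0// ltW.
by move: S1 xt; clear; lra.
Qed.

End LowerBounds.

(** * The straight segment on the second axis *)

Section Straight.
Context {R : realType}.
Implicit Types (s : R) (f phi : R -> R).

Local Notation mu := (@lebesgue_measure R).

Lemma continuous_L2_01 f : continuous f -> L2_01 f.
Proof.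
move=> cf.
have cf2 : {within `[0, 1], continuous (fun s => f s ^+ 2)}.
  by apply: continuous_subspaceT => s; apply: cvgM; exact: cf.
split; first by apply: measurable_funTS; exact: continuous_measurable_fun.
have /integrableP[_] := int01_continuous cf2.
by under eq_integral do rewrite /= ger0_norm ?sqr_ge0//.
Qed.

Lemma test_function_continuous phi : @test_function R phi -> continuous phi.
Proof.
by move=> [d _ _ _] s; apply: differentiable_continuous; exact/derivable1_diffP.
Qed.

Lemma test_function_ends phi : @test_function R phi -> phi 0 = 0 /\ phi 1 = 0.
Proof.
move=> [_ _ _ sub].
have H s : s \notin `]0, 1[ -> phi s = 0.
  move=> sJ; apply/eqP; apply: contraNT sJ => phis.
  by have /= := sub s; apply; exact: subset_closure.
by split; apply: H; rewrite in_itv/= ltxx ?andbF.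
Qed.

Lemma weak_derivative_linear (a : R) : weak_derivative (fun s => s * a) (fun _ => a).
Proof.
move=> phi tphi; have cphi := test_function_continuous tphi.
have [p0 p1] := test_function_ends tphi.
have [d c _ _] := tphi.
have cl : continuous (fun s : R => s * a).
  by move=> s; apply: cvgM; [exact: cvg_id|exact: cvg_cst].
have ca : continuous (fun _ : R => a) by move=> s; exact: cvg_cst.
rewrite !Rintegral_oo_cc; last 2 first.
- by move=> s; apply: cvgM; [exact: ca|exact: cphi].
- by move=> s; apply: cvgM; [exact: cl|exact: c].
have dl : derivable_oo_LRcontinuous (fun s : R => s * a) 0 1.
  split.
  - by move=> s _; apply: derivableM.
  - by apply: cvg_at_right_filter; exact: cl.
  - by apply: cvg_at_left_filter; exact: cl.
have dphi : derivable_oo_LRcontinuous phi 0 1.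
  split.
  - by move=> s _; exact: d.
  - by apply: cvg_at_right_filter; exact: cphi.
  - by apply: cvg_at_left_filter; exact: cphi.
have al : {in `]0, 1[, derive1 (fun s : R => s * a) =1 (fun=> a)}.
  move=> s _; rewrite derive1E.
  have -> : (fun s : R => s * a) = a \*: id.
    by apply/funext => r; rewrite /GRing.scale/= mulrC.
  by rewrite deriveZ// derive_id /GRing.scale/= mulr1.
have ibp := Rintegration_by_parts (@ltr01 R) (continuous_subspaceT ca) dl al
  (continuous_subspaceT c) dphi (fun _ _ => erefl).
by rewrite ibp p0 p1 !mulr0 subr0 sub0r.
Qed.

Lemma dist0_x2_axis_le (x2 : R) : (dist0 (vec4 0 x2 0 0) <= `|x2|%:E)%E.
Proof.
pose v := vec4 0 x2 0 0.
apply: ereal_inf_lbound; exists (fun s => s *: v), (fun=> 0), (fun=> x2); split.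
- split; [exact/continuous_L2_01/cst_continuous|exact/continuous_L2_01/cst_continuous|].
  exists (fun=> v).
  + split.
      apply: continuous_subspaceT => s.
      by apply: cvgZr_tmp; exact: cvg_id.
    move=> i; have -> : (fun s => (s *: v) ord0 i) = (fun s => s * v ord0 i).
      by apply/funext => s; rewrite mxE.
    split; [|exact/continuous_L2_01/cst_continuous|exact: weak_derivative_linear].
    apply: continuous_L2_01 => s.
    by apply: cvgM; [exact: cvg_id|exact: cvg_cst].
  + apply: aeW => s _; apply/rowP => i; rewrite !mxE/= mulr0.
    case: i => -[|[|[|[|//]]]] hi /=; ring.
- by rewrite scale0r.
- by rewrite scale1r.
- rewrite /horizontal_length; under eq_integral do rewrite expr0n/= add0r sqrtr_sqr.
  rewrite integral_cst//= lebesgue_measure_itv/= lte_fin ltr01.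
  by rewrite -EFinB subr0 mule1.
Qed.

End Straight.

(** * Flow of a constant vector field *)

Section ConstantField.
Context {R : realType} {n : nat}.
Implicit Types (w x : 'rV[R]_n.+1) (c : R -> 'rV[R]_n.+1).

Lemma is_derive_rowP c (t : R) w : is_derive t (1 : R) c w <->
  forall i, is_derive t (1 : R) (fun s => c s ord0 i) (w ord0 i).
Proof.
split=> [[dc Dc] i|dci].
  have dci := (derivable_mxP c t 1).1 dc.
  by apply: DeriveDef; [exact: dci|rewrite -Dc derive_mx// mxE].
have dc : derivable c t 1.
  by apply/derivable_mxP => i j; rewrite (ord1 i); have [] := dci j.
apply: DeriveDef => //; apply/rowP => i.
by rewrite derive_mx// mxE; have [] := dci i.
Qed.

(** The curve x + t w is an integral curve, and by the mean value theorem in each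
coordinate all of them end at x + w, which determines the choice made in
[exp_field]. *)
Lemma exp_field_cst w x : exp_field (fun=> w) x = x + w.
Proof.
apply: xget_unique.
  exists (fun t => x + t *: w); split.
  - move=> t _; apply/is_derive_rowP => i.
    have -> : (fun s => (x + s *: w) ord0 i) =
        cst (x ord0 i) + (w ord0 i) \*: (id : R -> R).
      by apply/funext => s; rewrite !mxE/= [s * _]mulrC.
    by apply: is_derive_eq; rewrite add0r /GRing.scale/= mulr1.
  - by rewrite scale0r addr0.
  - by rewrite scale1r.
move=> y [c [ic c0 c1]]; apply/rowP => i; rewrite mxE -c0 -c1.
have dci (t : R) : 0 <= t <= 1 -> is_derive t (1 : R) (fun t => c t ord0 i) (w ord0 i).
  by move=> /ic/is_derive_rowP.
have [t t01||r r01] := @MVT R (fun t => c t ord0 i) (fun=> w ord0 i) 0 1 ltr01.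
- by apply: dci; move: t01; rewrite in_itv/= => /andP[/ltW-> /ltW->].
- apply: derivable_within_continuous => t; rewrite in_itv/= => t01.
  by have [] := dci t t01.
- by rewrite subr0 mulr1 => /eqP; rewrite subr_eq addrC => /eqP.
Qed.

End ConstantField.

(** * Distance estimates *)

Section Distance.
Context {R : realType}.

Lemma dist0_ge (y1 y2 y3 y4 B : R) :
  (forall (xi u1 u2 : R -> R), engel_lift xi u1 u2 y1 y2 y4 ->
    B <= path_length u1 u2) ->
  (B%:E <= dist0 (vec4 y1 y2 y3 y4))%E.
Proof.
move=> H; apply: le_ereal_inf_tmp => _ [gamma [u1 [u2 [hp g0 g1 ->]]]].
have l := horizontal_path_lift hp g0 g1.
by rewrite (horizontal_lengthE (lift_int1 l) (lift_int2 l)) lee_fin; exact: H l.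
Qed.

(** A path of length at most |x2| + 1 obeys
8 |x4| <= (L - |x2|) (L + |x2|) L <= (L - |x2|) (2 |x2| + 1) (|x2| + 1). *)
Lemma dist0_vertical_ge (x2 x4 : R) :
  `|x4| < ((2 * `|x2| + 1) * (`|x2| + 1)) / 8 ->
  ((`|x2| + 8 / ((2 * `|x2| + 1) * (`|x2| + 1)) * `|x4|)%:E <=
   dist0 (vec4 0 x2 0 x4))%E.
Proof.
set a := `|x2|; set D := (2 * a + 1) * (a + 1) => x4D.
have a0 : 0 <= a by exact: normr_ge0.
have D0 : 0 < D by rewrite mulr_gt0 ?ltr_wpDl ?mulr_ge0.
apply: dist0_ge => xi u1 u2 l.
have est := lift_closed_estimate l; have aL := path_length_ge l.
rewrite -(real_normK (num_real x2)) -/a in est; rewrite -/a in aL.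
have -> : 8 / D * `|x4| = 8 * `|x4| / D by ring.
rewrite -lerBrDl ler_pdivrMr//.
move: (path_length u1 u2) (`|x4|) est aL x4D => L q est aL x4D.
have [La|La] := leP L (a + 1); last first.
  apply: (@le_trans _ _ D); first by move: x4D; clear; lra.
  by rewrite ler_pMl//; lra.
apply: (le_trans est).
have -> : (L ^+ 2 - a ^+ 2) * L = (L - a) * ((L + a) * L) by ring.
rewrite ler_wpM2l ?subr_ge0// /D.
by apply: ler_pM; lra.
Qed.

(** By contradiction: a path violating the bound has |xi| = O(y1) by
[lift_height], and the smallness of [y1] makes 4 K |xi| <= 1, so that
[lift_horizontal_estimate] applies with m = 4 K. *)
Lemma dist0_horizontal_ge (x2 K y1 : R) : 0 < K -> 0 < y1 ->
  y1 * (8 * K ^+ 2 * (K * (2 * `|x2| + K) + 1) + 1) <= 1 ->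
  ((`|x2| + K * y1 ^+ 2)%:E <= dist0 (vec4 y1 x2 0 0))%E.
Proof.
move=> K0 y0 small; apply: dist0_ge => xi u1 u2 l.
rewrite leNgt; apply/negP => Llt.
have aL := path_length_ge l.
set a := `|x2| in small Llt aL.
have a0 : 0 <= a by exact: normr_ge0.
pose M := K * (2 * a + K) + 1.
have M0 : 1 <= M by rewrite lerDr mulr_ge0 ?addr_ge0 ?mulr_ge0// ltW.
have KM : 0 <= 8 * K ^+ 2 * M.
  apply: mulr_ge0; last exact: le_trans M0.
  by rewrite mulr_ge0 ?sqr_ge0.
have y1le : y1 <= 1.
  apply: le_trans small; rewrite -/M ler_peMr ?(ltW y0)//; lra.
have bd t : 0 <= t <= 1 -> (4 * K) ^+ 2 * xi t ^+ 2 <= 1.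
  move=> /(lift_height l).
  rewrite -(real_normK (num_real x2)) -/a.
  move: (path_length u1 u2) Llt aL (xi t) => L Llt aL z hz.
  have hL : L ^+ 2 - a ^+ 2 <= y1 ^+ 2 * (K * (2 * a + K)).
    have -> : L ^+ 2 - a ^+ 2 = (L - a) * (L + a) by ring.
    have -> : y1 ^+ 2 * (K * (2 * a + K)) = (K * y1 ^+ 2) * (2 * a + K) by ring.
    have yy : y1 ^+ 2 <= 1 by rewrite expr_le1// ltW.
    have Ky : K * y1 ^+ 2 <= K by rewrite ler_piMr// ltW.
    by apply: ler_pM; lra.
  have hz2 : 4 * z ^+ 2 <= 2 * (2 * z - y1) ^+ 2 + 2 * y1 ^+ 2.
    by have := sqr_ge0 (2 * z - 2 * y1); clear; nra.
  have hz3 : 2 * z ^+ 2 <= y1 ^+ 2 * M.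
    by rewrite /M; move: hz hL hz2; clear; nra.
  have : (4 * K) ^+ 2 * z ^+ 2 <= y1 ^+ 2 * (8 * K ^+ 2 * M).
    have -> : (4 * K) ^+ 2 * z ^+ 2 = (8 * K ^+ 2) * (2 * z ^+ 2) by ring.
    have -> : y1 ^+ 2 * (8 * K ^+ 2 * M) = (8 * K ^+ 2) * (y1 ^+ 2 * M) by ring.
    by rewrite ler_wpM2l// mulr_ge0 ?sqr_ge0.
  move=> /le_trans; apply; apply: le_trans small; rewrite -/M expr2 -mulrA.
  rewrite ler_wpM2l ?(ltW y0)//.
  move: KM y1le y0; move: (8 * K ^+ 2 * M) => P; clear; nra.
have m0 : 0 < 4 * K by rewrite mulr_gt0.
have := lift_horizontal_estimate l y0 m0 bd; rewrite -/a.
have -> : 4 * K * y1 ^+ 2 / 4 = K * y1 ^+ 2 by field.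
by rewrite leNgt Llt.
Qed.

Lemma exp_field_y1 (x2 y1 : R) :
  exp_field (fun x => y1 *: X1 x + 0 *: X2 x) (vec4 0 x2 0 0) = vec4 y1 x2 0 0.
Proof.
have -> : (fun x => y1 *: X1 x + 0 *: X2 x) = fun=> vec4 y1 0 0 0.
  apply/funext => x; apply/rowP => i; rewrite !mxE mul0r addr0.
  by case: i => -[|[|[|[|//]]]] hi /=; rewrite ?mulr1 ?mulr0.
rewrite exp_field_cst; apply/rowP => i; rewrite !mxE.
by case: i => -[|[|[|[|//]]]] hi /=; rewrite ?add0r ?addr0.
Qed.

End Distance.

Theorem theorem1p2 (R : realType) (x2 : R) :
  (exists2 C : R, 0 < C &
     exists2 delta : R, 0 < delta &
       forall x4 : R, `|x4| < delta ->
         ((C * `|x4|)%:E <=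
            dist0 (vec4 0 x2 0 x4) - dist0 (vec4 0 x2 0 0))%E)
  /\
  limf_esup
    (fun y : R * R =>
       (dist0 (exp_field (fun x => (y.1 *: X1 x + y.2 *: X2 x)%R) (vec4 0 x2 0 0))
          - dist0 (vec4 0 x2 0 0)) / (y.1 ^+ 2 + y.2 ^+ 2)%R%:E)%E
    (dnbhs (0 : R * R)) = +oo%E.
Proof.
have a0 : 0 <= `|x2| by exact: normr_ge0.
have gap (z : 'rV[R]_4) B : ((`|x2| + B)%:E <= dist0 z)%E ->
    (B%:E <= dist0 z - dist0 (vec4 0 x2 0 0))%E.
  move=> H; have := leeB H (dist0_x2_axis_le x2).
  by rewrite -EFinB addrC addKr.
split.
  pose D := (2 * `|x2| + 1) * (`|x2| + 1).
  have D0 : 0 < D by rewrite mulr_gt0 ?ltr_wpDl ?mulr_ge0.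
  (* With these constants C |x4| < 1, which settles the paths longer than
     |x2| + 1. *)
  exists (8 / D); first by rewrite divr_gt0.
  exists (D / 8); first by rewrite divr_gt0.
  by move=> x4 hx4; apply: gap; exact: dist0_vertical_ge.
apply/eqyP => K K0; apply: le_ereal_inf_tmp => _ [V V0 <-].
have [e e0 eV] : exists2 e, 0 < e & forall y1, 0 < y1 < e -> V (y1, 0).
  have /nbhs_ballP[e /= e0 eV] := V0; exists e => // y1 /andP[y0 ye].
  apply: eV => /=; last by rewrite xpair_eqE negb_and gt_eqF.
  by split; rewrite /= /ball/= sub0r normrN ?normr0// gtr0_norm.
(* The smallness condition of [dist0_horizontal_ge] reads y1 * S <= 1. *)
pose S := 8 * K ^+ 2 * (K * (2 * `|x2| + K) + 1) + 1.
have S0 : 0 < S.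
  by rewrite ltr_wpDl// !mulr_ge0 ?addr_ge0 ?mulr_ge0 ?addr_ge0 ?mulr_ge0// ltW.
pose y1 := Num.min (e / 2) S^-1.
have y0 : 0 < y1 by rewrite lt_min divr_gt0//= invr_gt0.
have ye : y1 < e by rewrite gt_min; apply/orP; left; lra.
have yS : y1 * S <= 1 by rewrite -ler_pdivlMr// div1r ge_min lexx orbT.
apply: le_trans (ereal_sup_ubound _); last first.
  by exists (y1, 0) => //; apply: eV; rewrite y0.
rewrite /= expr0n/= addr0 exp_field_y1 inver ifF; last first.
  by apply/negbTE; rewrite expf_neq0// gt_eqF.
rewrite lee_pdivlMr ?exprn_gt0// -EFinM; apply: gap.
exact: dist0_horizontal_ge.
Qed.
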